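(* There exists $N$ such that for all integers $n\ge N$, all $k\in\{2,\dots,n-1\}$ and all $\gamma\in(0,1)$ satisfying $\frac{k}{\gamma}\le\frac{\sqrt n}{100}$, the non-deterministic communication complexity (in the $k$-party number-in-hand model) of $\mathrm{DISJ}'_{k,\gamma}(n)$ is at least $\frac{\gamma^2 n}{10^4\cdot k}-2\log_2(n)$.
   Context: $[n]=\{1,\dots,n\}$, $\binom{[n]}{a}$ is the set of $a$-element subsets of $[n]$, $\triangle$ is symmetric difference. $\mathrm{DISJ}'_{k,\gamma}(n)$ is the following partial function of $k$ inputs: party $i$ ($i=1,\dots,k$) receives $X_i\in\binom{[n]}{\lfloor n/k\rfloor}$; it is promised that either $X_1,\dots,X_k$ are pairwise disjoint (then the value is $1$) or $|X_i\triangle X_{i'}|\le\gamma\lfloor n/k\rfloor$ for all $i,i'\in[k]$ (then the value is $0$). Number-in-hand model: $k$ parties compute a (partial) function $f\colon\mathcal X_1\times\dots\times\mathcal X_k\to\{0,1\}$, party $i$ knowing only $X_i\in\mathcal X_i$; they write binary messages on a shared blackboard seen by all. A deterministic protocol specifies, as a function of the blackboard contents, whose turn it is to write, and the message written (a function of the blackboard and that party's input); at the end the output bit is a function of the blackboard contents. Its cost $CC(\pi)$ is the maximum over inputs of the number of bits written. A non-deterministic protocol is a finite set $\mathcal P$ of deterministic protocols, with cost $CC(\mathcal P)=\lceil\log_2|\mathcal P|\rceil+\max_{\pi\in\mathcal P}CC(\pi)$. It computes $f$ if for every input with $f=1$ some $\pi\in\mathcal P$ outputs $1$, and for every input with $f=0$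 every $\pi\in\mathcal P$ outputs $0$. The non-deterministic communication complexity of $f$ is the minimum cost of a non-deterministic protocol computing $f$. *)

(* Defs.v *)
From Stdlib Require Import Reals List.
From mathcomp Require Import all_boot.

Set Implicit Arguments.
Unset Strict Implicit.
Unset Printing Implicit Defensive.

Definition input (k n : nat) := {ffun 'I_k -> {set 'I_n}}.

Definition in_domain (k n : nat) (X : input k n) : bool :=
  [forall i, #|X i| == n %/ k].

(* Deterministic number-in-hand blackboard protocol, as a protocol tree:
   the blackboard contents are the path from the root; at an internal node
   the blackboard determines whose turn it is ([i]) and the bit written is a
   function [f] of that party's input only; at a leaf the output bit is a
   function of the blackboard. *)
Inductive protocol (k n : nat) : Type :=
  | Leaf of bool
  | Node of 'I_k & ({set 'I_n} -> bool) & protocol k n & protocol k n.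

Fixpoint run (k n : nat) (p : protocol k n) (X : input k n) : bool * nat :=
  match p with
  | Leaf b => (b, 0)
  | Node i f p0 p1 =>
      let r := run (if f (X i) then p1 else p0) X in (r.1, r.2.+1)
  end.

Definition det_cost (k n : nat) (p : protocol k n) : nat :=
  \max_(X : input k n | in_domain X) (run p X).2.

(* A non-deterministic protocol is a finite family of deterministic ones;
   cost = ceil(log2 |P|) + max_{pi in P} CC(pi).  up_log 2 m = ceil(log2 m). *)
Definition nd_cost (k n : nat) (P : seq (protocol k n)) : nat :=
  up_log 2 (size P) + \max_(p <- P) det_cost p.

Definition nd_computes (k n : nat) (P : seq (protocol k n))
    (one zero : input k n -> Prop) : Prop :=
  (forall X, one X -> exists2 p, List.In p P & (run p X).1 = true) /\
  (forall X, zero X -> forall p, List.In p P -> (run p X).1 = false).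

Definition disj_one (k n : nat) (X : input k n) : Prop :=
  in_domain X /\ forall i j : 'I_k, i != j -> [disjoint X i & X j].

Definition symdiff_card (n : nat) (A B : {set 'I_n}) : nat :=
  #|(A :\: B) :|: (B :\: A)|.

Definition disj_zero (k n : nat) (gamma : R) (X : input k n) : Prop :=
  in_domain X /\
  forall i j : 'I_k, Rle (INR (symdiff_card (X i) (X j))) (Rmult gamma (INR (n %/ k))).

Definition ndcc_disj_ge (k n : nat) (gamma : R) (r : R) : Prop :=
  forall P : seq (protocol k n),
    nd_computes P (@disj_one k n) (disj_zero gamma) -> Rle r (INR (nd_cost P)).

Definition log2 (x : R) : R := Rdiv (ln x) (ln 2).

(* Main.v *)
Require Import Defs.
From Stdlib Require Import Reals ZArith Classical Lra.
From mathcomp Require Import all_boot all_order all_algebra fingroup perm.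
From mathcomp Require Import Rstruct.
From mathcomp Require ring.

(* A uniformly random permutation of one fixed tuple of disjoint sets is a hard
   distribution on 1-inputs.  A protocol of cost c covers its support with at
   most 2^c rectangles A_1 x ... x A_k containing no 0-input, so some rectangle
   has measure at least 2^-c; then each A_i has density at least 2^-c in the
   slice of m-subsets, m = n / k.  By concentration of measure on the slice,
   all but a fraction < 1/k of the m-sets are within distance gamma m / 4 of A_i
   if c is too small, so some m-set is that close to every A_i.  Its nearest
   neighbours in A_1, ..., A_k then form a 0-input of the rectangle, a
   contradiction. *)

Set Implicit Arguments.
Unset Strict Implicit.
Unset Printing Implicit Defensive.
Import GRing.Theory Num.Theory.

(** * Permutations acting on subsets of a finite type *)

Lemma card_perm_type (T : finType) : #|{perm T}| = #|T|`!.
Proof.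
rewrite -(cardsT T) -card_perm; apply: eq_card => s.
by apply/esym/subsetP => x; rewrite inE.
Qed.

(** Listing each set followed by its complement enumerates [T] twice; matching the two lists
    position by position gives the permutation. *)
Lemma exists_perm_imset (T : finType) (S S' : {set T}) :
  #|S| = #|S'| -> exists s : {perm T}, s @: S = S'.
Proof.
move=> eqSS'.
pose e (B : {set T}) := enum B ++ enum (~: B).
have size_e B : size (e B) = #|T| by rewrite size_cat -!cardE cardsC.
have uniq_e B : uniq (e B).
  rewrite cat_uniq !enum_uniq andbT /=; apply/hasPn => x.
  by rewrite !mem_enum inE.
have mem_e B x : x \in e B by rewrite mem_cat !mem_enum inE; case: (x \in B).
pose f x := nth x (e S') (index x (e S)).
have ltf x : index x (e S) < size (e S') by rewrite size_e -(size_e S) index_mem.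
have injf : injective f.
  move=> x y; rewrite /f (set_nth_default y x (ltf x)) => /eqP.
  rewrite nth_uniq // => /eqP eqi.
  by rewrite -(nth_index x (mem_e S x)) eqi (nth_index x (mem_e S y)).
exists (perm injf); apply/eqP.
rewrite eqEcard card_imset ?eqSS' ?leqnn ?andbT; last exact: perm_inj.
apply/subsetP => _ /imsetP[x xS ->]; rewrite permE /f.
rewrite !index_cat mem_enum xS nth_cat.
have lt : index x (enum S) < size (enum S') by rewrite -cardE -eqSS' cardE index_mem mem_enum.
by rewrite lt -mem_enum mem_nth.
Qed.

(** Under a uniformly random permutation, the image of [S] is uniform among sets of its size: right
    multiplication by a permutation carrying [S] to [S'] maps the fibre over [S] bijectively onto
    the fibre over [S']. *)
Lemma card_perm_imset_in (T : finType) (S : {set T}) (A : {set {set T}}) :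
    (forall S' : {set T}, S' \in A -> #|S'| = #|S|) ->
  #|[set s : {perm T} | s @: S \in A]| * 'C(#|T|, #|S|) = #|A| * #|T|`!.
Proof.
move=> cardA.
pose fib (S' : {set T}) := [set s : {perm T} | s @: S == S'].
have card_fib (S' : {set T}) : #|S'| = #|S| -> #|fib S'| = #|fib S|.
  move=> /esym /exists_perm_imset[t tS].
  rewrite -(card_imset (fib S) (@mulIg _ t)); apply: eq_card => s.
  apply/idP/imsetP => [|[u]]; rewrite !inE => /eqP sS.
    exists (s * t^-1)%g; last by rewrite mulgKV.
    rewrite inE; apply/eqP; rewrite -[RHS](imset_id S).
    rewrite (eq_imset _ (permM s t^-1)) imset_comp sS -tS -imset_comp.
    by rewrite imset_id -[RHS]imset_id; apply: eq_imset => x /=; rewrite permK.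
  by move=> ->; rewrite (eq_imset _ (permM u t)) imset_comp sS tS.
have card_sum (B : {set {set T}}) : (forall S' : {set T}, S' \in B -> #|S'| = #|S|) ->
    #|[set s : {perm T} | s @: S \in B]| = #|B| * #|fib S|.
  move=> cardB; rewrite -sum1_card (partition_big (fun s : {perm T} => s @: S) (mem B)) /=.
    rewrite -sum_nat_const; apply: eq_bigr => S' S'B.
    rewrite -(card_fib S') ?cardB // -sum1_card; apply: eq_bigl => s.
    rewrite !inE; case: eqP => [->|]; by rewrite ?S'B ?andbF.
  by move=> s; rewrite inE.
(* Taking the whole slice as the family determines the common fibre size. *)
have <- : #|[set S' : {set T} | #|S'| == #|S|]| * #|fib S| = #|T|`!.
  rewrite -card_sum => [|C]; last by rewrite inE => /eqP.
  rewrite -card_perm_type; apply: eq_card => s.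
  by rewrite !inE card_imset ?eqxx //; apply: perm_inj.
by rewrite card_draws card_sum // mulnAC mulnA.
Qed.

(** * Concentration of measure on the slice of m-subsets *)

Section SliceConcentration.

Import ring.
Import Order.TTheory.

Variables (F : realFieldType) (T : finType).
Implicit Types (f g : {set T} -> F) (B C : {set T}) (A : {set {set T}}) (r m : nat).
Local Open Scope ring_scope.

(** Sum over ordered extensions of [B] by [r] new elements. Revealing one element at a time turns an
    estimate on the slice into an induction, at the price of a factor [r]!. *)
Fixpoint ext_sum f r B : F :=
  if r is r'.+1 then \sum_(x in ~: B) ext_sum f r' (x |: B) else f B.

Lemma ext_sum_gt0 f r B :
  (forall C, 0 < f C) -> (#|B| + r <= #|T|)%N -> 0 < ext_sum f r B.
Proof.
move=> f_gt0; elim: r B => [|r IHr] B //= ler.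
have /card_gt0P[x xB] : (0 < #|~: B|)%N.
  by rewrite cardsCs setCK subn_gt0 (leq_trans _ ler) // -addSnnS leq_addr.
have ext_gt0 y : y \in ~: B -> 0 < ext_sum f r (y |: B).
  by rewrite inE => yB; rewrite IHr // cardsU1 yB add1n addSnnS.
rewrite (bigD1 x) //= ltr_wpDr ?ext_gt0 //.
by apply: sumr_ge0 => y /andP[yB _]; rewrite ltW ?ext_gt0.
Qed.

(** The permutation carries the complement of [B] onto that of its image, so a pointwise ratio bound
    survives each summation after reindexing. *)
Lemma ext_sum_perm f q (s : {perm T}) r B :
    (forall C, f (s @: C) <= q * f C) ->
  ext_sum f r (s @: B) <= q * ext_sum f r B.
Proof.
move=> fs; elim: r B => [|r IHr] B //=.
rewrite (reindex_inj (@perm_inj _ s)) mulr_sumr /=.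
rewrite [X in X <= _](eq_bigl (mem (~: B))) => [|x]; last first.
  by rewrite !inE mem_imset //; apply: perm_inj.
by apply: ler_sum => x _; rewrite -[in leLHS]imset_set1 -imsetU.
Qed.

Lemma ext_sumE f r B :
  ext_sum f r B =
    (r`!)%:R * \sum_(C : {set T} | (B \subset C) && (#|C| == #|B| + r)%N) f C.
Proof.
elim: r B => [|r IHr] B /=.
  rewrite mul1r (big_pred1 B) // => C.
  rewrite addn0 /= [RHS]eq_sym eqEcard; case: (boolP (B \subset C)) => //=.
  by move/subset_leq_card; rewrite eqn_leq => ->; rewrite andbT.
under eq_bigr => x _ do rewrite IHr.
rewrite -mulr_sumr factS mulnC natrM -mulrA; congr (_ * _).
(* Each [C] of the target size arises once for every choice of the first new element in [C :\: B],
   hence [r.+1] times. *)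
rewrite (exchange_big_dep (fun C : {set T} => (B \subset C) && (#|C| == #|B| + r.+1)%N)) /=.
  rewrite mulr_sumr; apply: eq_bigr => C /andP[sBC /eqP cardC].
  rewrite (eq_bigl (mem (C :\: B))) => [|x].
    by rewrite sumr_const cardsD (setIidPr sBC) cardC addKn mulr_natl.
  rewrite !inE subUset sub1set sBC andbT; case: (boolP (x \in B)) => //= xB.
  by rewrite cardsU1 xB cardC add1n addSnnS eqxx andbT.
move=> x C; rewrite inE => xB; rewrite subUset => /andP[/andP[_ ->]] /eqP ->.
by rewrite cardsU1 xB add1n addSnnS /=.
Qed.

Lemma ext_sum0 f m :
  ext_sum f m set0 = (m`!)%:R * \sum_(C : {set T} | #|C| == m) f C.
Proof.
rewrite ext_sumE; congr (_ * _); apply: eq_bigl => C.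
by rewrite sub0set cards0.
Qed.

(** The left side is at most K (u + 1/u) with u = a/a'. Since u lies between 1/q and q, u + 1/u is
    at most q + 1/q. *)
Lemma cross_mul_le (a a' b b' q c K : F) :
    0 < a -> 0 < a' -> 0 < q -> q + q^-1 <= 2 * c ->
    a * b <= K -> a' * b' <= K -> 0 <= K -> a <= q * a' -> a' <= q * a ->
  a * b' + a' * b <= 2 * c * K.
Proof.
move=> a0 a'0 q0 qc abK a'b'K K0 aa' a'a.
have aa'0 : 0 < a * a' by rewrite mulr_gt0.
rewrite -(ler_pM2r aa'0).
have le1 : (a * b' + a' * b) * (a * a') <= K * (a ^+ 2 + a' ^+ 2).
  have -> : (a * b' + a' * b) * (a * a') = (a' * b') * a ^+ 2 + (a * b) * a' ^+ 2 by ring.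
  by rewrite mulrDr lerD // ler_wpM2r // sqr_ge0.
have le2 : a ^+ 2 + a' ^+ 2 <= (q + q^-1) * (a * a').
  rewrite -(ler_pM2l q0).
  have -> : q * ((q + q^-1) * (a * a')) = (q ^+ 2 + 1) * (a * a') by field; rewrite gt_eqF.
  have -> : (q ^+ 2 + 1) * (a * a')
      = (q * a' - a) * (q * a - a') + q * (a ^+ 2 + a' ^+ 2) by ring.
  by rewrite lerDr mulr_ge0 // subr_ge0.
rewrite [leRHS]mulrAC [leRHS]mulrC; apply: le_trans le1 _; apply: ler_wpM2l => //.
by apply: le_trans le2 _; rewrite ler_wpM2r // ltW.
Qed.

(* Symmetrising over the two choices of the next element is what makes each
   step cost (q + 1/q) / 2 = 1 + O((q - 1)^2) instead of q. *)
Lemma ext_sum_mul_le f g (q c : F) r B :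
    (forall C, 0 < f C) -> (forall C, 0 < g C) -> (forall C, f C * g C <= 1) ->
    0 < q -> q + q^-1 <= 2 * c ->
    (forall x y C, f (tperm x y @: C) <= q * f C) ->
    (#|B| + r <= #|T|)%N ->
  ext_sum f r B * ext_sum g r B <= c ^+ r * (((#|T| - #|B|) ^_ r)%:R ^+ 2).
Proof.
move=> f_gt0 g_gt0 fg1 q_gt0 qc f_tperm.
have c_gt0 : 0 < c.
  have : 0 < 2 * c by apply: lt_le_trans qc; rewrite addr_gt0 ?invr_gt0.
  by rewrite pmulr_rgt0 // ltr0n.
elim: r B => [|r IHr] B ler /=; first by rewrite expr0 ffactn0 mul1r expr1n.
set n := (#|T| - #|B|)%N in IHr *.
have card_n : #|~: B| = n by rewrite cardsCs setCK.
set a := fun x => ext_sum f r (x |: B); set b := fun x => ext_sum g r (x |: B).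
pose K := c ^+ r * ((n.-1 ^_ r)%:R ^+ 2).
have K_ge0 : 0 <= K by rewrite mulr_ge0 ?exprn_ge0 ?ler0n // ltW.
have ltB x : x \in ~: B -> (#|x |: B| = #|B|.+1) by rewrite inE cardsU1 => ->.
have abK x : x \in ~: B -> a x * b x <= K.
  move=> xB; have /IHr : (#|x |: B| + r <= #|T|)%N by rewrite ltB // addSnnS.
  by rewrite ltB // subnS.
have a_gt0 x : x \in ~: B -> 0 < a x.
  by move=> xB; rewrite ext_sum_gt0 // ltB // addSnnS.
have a_tperm x y : x \in ~: B -> y \in ~: B -> a x <= q * a y.
  rewrite !inE => xB yB.
  (* Swapping x and y fixes [B] and turns [y |: B] into [x |: B], so extension sums for different
     next elements differ by a factor at most [q]. *)
  have -> : a x = ext_sum f r (tperm x y @: (y |: B)).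
    congr ext_sum; rewrite imsetU1 tpermR; congr (_ |: _).
    rewrite -[LHS]imset_id; apply: eq_in_imset => z zB.
    by rewrite tpermD //; apply: contraTneq zB => <-.
  by apply: ext_sum_perm => C; apply: f_tperm.
have : \sum_(x in ~: B) \sum_(y in ~: B) (a x * b y + a y * b x)
       <= \sum_(x in ~: B) \sum_(y in ~: B) 2 * c * K.
  apply: ler_sum => x xB; apply: ler_sum => y yB.
  by apply: (@cross_mul_le (a x) (a y) (b x) (b y) q); rewrite ?a_gt0 ?abK ?a_tperm.
(* The symmetrised double sum is twice the wanted product. It has n^2 terms, and n times the falling
   factorial of n - 1 is the next falling factorial, squared here. *)
have -> : \sum_(x in ~: B) \sum_(y in ~: B) (a x * b y + a y * b x)
    = 2 * ((\sum_(x in ~: B) a x) * \sum_(y in ~: B) b y).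
  have eq_sum : \sum_(x in ~: B) \sum_(y in ~: B) a x * b y
      = (\sum_(x in ~: B) a x) * \sum_(y in ~: B) b y.
    by rewrite big_distrl; apply: eq_bigr => x _; rewrite big_distrr.
  rewrite mulr_natl mulr2n -{2}eq_sum [X in _ + X]exchange_big -eq_sum /=.
  by rewrite -big_split; apply: eq_bigr => x _; rewrite -big_split.
rewrite !sumr_const card_n => le2.
rewrite -(@ler_pM2l _ 2) ?ltr0n //; apply: le_trans le2 _.
rewrite ffactnS -mulrnA -[leLHS]mulr_natr !natrM /K [c ^+ r.+1]exprS.
 rewrite le_eqVlt; apply/orP; left; apply/eqP; ring.
Qed.

(** Extensions of the empty set, with the orderings divided out. For g = 1/f it bounds the product
    of the averages of f and 1/f over the slice by c^m. *)
Lemma slice_mul_le f g (q c : F) m :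
    (forall C, 0 < f C) -> (forall C, 0 < g C) -> (forall C, f C * g C <= 1) ->
    0 < q -> q + q^-1 <= 2 * c ->
    (forall x y C, f (tperm x y @: C) <= q * f C) ->
    (m <= #|T|)%N ->
  (\sum_(C : {set T} | #|C| == m) f C) * (\sum_(C : {set T} | #|C| == m) g C)
    <= c ^+ m * ('C(#|T|, m)%:R ^+ 2).
Proof.
move=> f_gt0 g_gt0 fg1 q_gt0 qc f_tperm lem.
have := @ext_sum_mul_le f g q c m set0 f_gt0 g_gt0 fg1 q_gt0 qc f_tperm.
rewrite cards0 subn0 => /(_ lem); rewrite !ext_sum0 -bin_ffact natrM.
set u := \sum_(_ | _) _; set v := \sum_(_ | _) _ => le1.
have fact2_gt0 : (0 : F) < m`!%:R ^+ 2 by rewrite exprn_gt0 // ltr0n fact_gt0.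
rewrite -(ler_pM2l fact2_gt0).
have -> : m`!%:R ^+ 2 * (u * v) = m`!%:R * u * (m`!%:R * v) by ring.
by apply: le_trans le1 _; rewrite [leRHS]mulrCA -exprMn [m`!%:R * _]mulrC.
Qed.

(** For nonempty [A] this is the least [#|C :\: X|] over X in [A], half the symmetric difference
    when the sizes agree; for empty [A] it is [#|C|]. *)
Definition slice_dist (A : {set {set T}}) (C : {set T}) : nat :=
  #|C| - \max_(X in A) #|C :&: X|.

(** A transposition removes at most one element from [C], so each intersection with a member of [A]
    loses at most one element. *)
Lemma slice_dist_tperm A x y C :
  (slice_dist A (tperm x y @: C) <= (slice_dist A C).+1)%N.
Proof.
rewrite /slice_dist card_imset; last exact: perm_inj.
rewrite leq_subLR addnS -addSn.
suff le1 : (\max_(X in A) #|C :&: X| <= (\max_(X in A) #|tperm x y @: C :&: X|).+1)%N.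
  by rewrite (leq_trans _ (leq_add le1 (leqnn _))) // -leq_subLR.
apply/bigmax_leqP => X XA.
apply: (@leq_trans (#|tperm x y @: C :&: X|.+1)); last first.
  by rewrite ltnS (leq_bigmax_cond (F := fun X => #|_ :&: X|)).
have [xC|xC] := boolP (x \in C).
  have [yC|yC] := boolP (y \in C).
    apply/leqW/subset_leq_card/setSI/subsetP => z zC; apply/imsetP.
    exists (tperm x y z); last by rewrite tpermK.
    by case: tpermP => // ->.
  rewrite (cardsD1 x (C :&: X)) -add1n leq_add ?leq_b1 //.
  apply/subset_leq_card/subsetP => z; rewrite !inE => /and3P[zx zC ->].
  rewrite andbT; apply/imsetP; exists z => //.
  by rewrite tpermD // 1?eq_sym //; apply: contraTneq zC => ->.
rewrite (cardsD1 y (C :&: X)) -add1n leq_add ?leq_b1 //.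
apply/subset_leq_card/subsetP => z; rewrite !inE => /and3P[zx zC ->].
rewrite andbT; apply/imsetP; exists z => //.
by rewrite tpermD // 1?eq_sym //; apply: contraTneq zC => ->.
Qed.

Lemma slice_dist_eq0 A C : C \in A -> slice_dist A C = 0%N.
Proof.
move=> CA; apply/eqP; rewrite /slice_dist subn_eq0.
have {1}-> : #|C| = #|C :&: C| by rewrite setIid.
by rewrite (leq_bigmax_cond (F := fun X => #|C :&: X|)).
Qed.

Lemma slice_dist_attained A C :
  A != set0 -> exists2 X, X \in A & #|C :\: X| = slice_dist A C.
Proof.
rewrite -card_gt0 => /(eq_bigmax_cond (fun X => #|C :&: X|))[X XA maxX].
by exists X => //; rewrite /slice_dist maxX cardsD.
Qed.

(** Exponential moment argument with f = q^dist: far sets contribute at least q^t each to the sum of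
    f, while members of [A] have distance 0 and contribute 1 each to the sum of 1/f. *)
Lemma slice_concentration (A : {set {set T}}) (q c : F) m t :
    (forall X, X \in A -> #|X| = m) -> (m <= #|T|)%N ->
    1 <= q -> q + q^-1 <= 2 * c ->
  #|[set C : {set T} | (#|C| == m) && (t <= slice_dist A C)%N]|%:R * #|A|%:R * q ^+ t
    <= c ^+ m * ('C(#|T|, m)%:R ^+ 2).
Proof.
move=> cardA lem q_ge1 qc.
have q_gt0 : 0 < q by apply: lt_le_trans q_ge1; rewrite ltr01.
pose f C := q ^+ slice_dist A C.
have f_gt0 C : 0 < f C by rewrite exprn_gt0.
have := @slice_mul_le f (fun C => (f C)^-1) q c m f_gt0.
move=> /(_ _ _ q_gt0 qc _ lem) le1.
apply: le_trans (le1 _ _ _); first last.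
- move=> x y C; rewrite -exprS; apply: ler_weXn2l => //; exact: slice_dist_tperm.
- by move=> C; rewrite mulfV ?gt_eqF.
- by move=> C; rewrite invr_gt0.
rewrite mulrAC; apply: ler_pM; rewrite ?ler0n //.
- by rewrite mulr_ge0 ?ler0n ?exprn_ge0 // ltW.
- rewrite mulr_natl -sumr_const [leLHS]big_mkcond [leRHS]big_mkcond /=.
  apply: ler_sum => C _; rewrite inE; case: (#|C| == m) => //=.
  by case: ifP => [letd|_]; [apply: ler_weXn2l | rewrite ltW].
rewrite -sumr_const [leLHS]big_mkcond [leRHS]big_mkcond /=.
apply: ler_sum => C _; case: ifP => [CA|_].
  by rewrite cardA // eqxx /f slice_dist_eq0 // expr0 invr1.
by case: ifP => // _; rewrite invr_ge0 ltW.
Qed.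

End SliceConcentration.

(** * Rectangle covers obtained from protocols *)

Section Rectangles.

Variables (k n : nat) (I : finType) (X : I -> input k n).
Implicit Types (A : 'I_k -> {set {set 'I_n}}) (Y : input k n) (Z : input k n -> Prop).

Definition in_rect A Y := [forall i, Y i \in A i].

Definition rect_avoids Z A := forall Y, in_rect A Y -> ~ Z Y.

(** A bit written by party i splits only side i of the rectangle, doubling the number of rectangles
    and using one unit of the budget [c]. At an accepting leaf the rectangle avoids [Z], so the
    bound [M] applies. *)
Lemma protocol_rect_bound Z (M : nat) (p : protocol k n) (c : nat) A :
    (forall A', rect_avoids Z A' -> #|[set s | in_rect A' (X s)]| <= M) ->
    (forall Y, in_rect A Y -> Z Y -> (run p Y).1 = false) ->
    (forall Y, in_rect A Y -> (run p Y).2 <= c) ->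
  #|[set s | in_rect A (X s) && (run p (X s)).1]| <= 2 ^ c * M.
Proof.
move=> boundM.
elim: p A c => [b|i f p0 IH0 p1 IH1] A c /= zeroP costP.
  case: b zeroP => /= zeroP.
    apply: leq_trans (leq_pmull M _); last by rewrite expn_gt0.
    apply: leq_trans (boundM A _); last by move=> Y /zeroP /[apply].
    by apply/subset_leq_card/subsetP => s; rewrite !inE andbT.
  by rewrite (_ : [set _ | _] = set0) ?cards0 //; apply/setP => s; rewrite !inE andbF.
(* A node writes a bit, so with budget 0 the rectangle contains no input. *)
case: c costP => [|c] costP.
  rewrite (_ : [set _ | _] = set0) ?cards0 //; apply/setP => s; rewrite !inE.
  by apply/negP => /andP[/costP].
pose side (b : bool) j := if j == i then [set S in A j | f S == b] else A j.
have sideP b Y : in_rect (side b) Y = in_rect A Y && (f (Y i) == b).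
  apply/forallP/andP => [YA|[/forallP YA fY] j].
    split; last by have := YA i; rewrite /side eqxx inE => /andP[].
    by apply/forallP => j; have := YA j; rewrite /side; case: eqP; rewrite ?inE // => _ /andP[].
  by rewrite /side; case: eqP => [->|_]; rewrite ?inE YA.
rewrite expnS mul2n -addnn mulnDl.
pose cell b p := [set s | in_rect (side b) (X s) && (run p (X s)).1].
apply: (@leq_trans (#|cell false p0 :|: cell true p1|)).
  apply/subset_leq_card/subsetP => s; rewrite !inE !sideP.
  by case: (f (X s i)); rewrite /= ?andbT ?andbF ?orbF.
apply: leq_trans (leq_card_setU _ _) _; apply: leq_add.
  apply: IH0 => Y; rewrite sideP => /andP[YA /eqP fY].
    by move=> /(zeroP _ YA); rewrite fY.
  by have := costP _ YA; rewrite fY.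
apply: IH1 => Y; rewrite sideP => /andP[YA /eqP fY].
  by move=> /(zeroP _ YA); rewrite fY.
by have := costP _ YA; rewrite fY.
Qed.

Lemma leq_bigmax_In (T : Type) (s : seq T) (F : T -> nat) x :
  List.In x s -> F x <= \max_(y <- s) F y.
Proof.
elim: s => //= y s IHs; rewrite big_cons leq_max => -[->|/IHs ->].
  by rewrite leqnn.
by rewrite orbT.
Qed.

Lemma card_cover_le (T : Type) (s : seq T) (P : T -> pred I) (b : nat) :
    (forall x, List.In x s -> #|[set i | P x i]| <= b) ->
    (forall i, exists2 x, List.In x s & P x i) ->
  #|I| <= size s * b.
Proof.
move=> cardP coverP.
apply: (@leq_trans #|[set i | has (P^~ i) s]|).
  rewrite -cardsT; apply/subset_leq_card/subsetP => i _; rewrite inE.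
  have [x] := coverP i; elim: s {cardP coverP} => //= y s IHs [->|/IHs hs /hs ->].
    by move=> ->.
  by rewrite orbT.
elim: s cardP {coverP} => [|x s IHs] cardP /=.
  by rewrite (_ : [set _ | _] = set0) ?cards0 //; apply/setP => i; rewrite !inE.
rewrite mulSn; apply: (@leq_trans #|[set i | P x i] :|: [set i | has (P^~ i) s]|).
  by apply/subset_leq_card/subsetP => i; rewrite !inE.
apply: leq_trans (leq_card_setU _ _) _; apply: leq_add; first by apply: cardP; left.
by apply: IHs => y ys; apply: cardP; right.
Qed.

(** Pigeonhole: all protocols together have at most [2 ^ nd_cost P] accepting rectangles, which
    avoid the 0-inputs and cover every [X i]. *)
Lemma exists_heavy_rect (P : seq (protocol k n)) (one zero : input k n -> Prop) :
    0 < #|I| -> nd_computes P one zero ->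
    (forall i, one (X i)) -> (forall Y, one Y -> in_domain Y) ->
  exists A, [/\ rect_avoids zero A,
    forall j S, S \in A j -> #|S| = n %/ k
    & #|I| <= 2 ^ nd_cost P * #|[set i | in_rect A (X i)]|].
Proof.
move=> I_gt0 [oneP zeroP] oneX one_dom; apply: NNPP => no_heavy.
(* [det_cost] only bounds runs on domain inputs, so the trees are followed inside this rectangle;
   intersecting with it also fixes the set sizes. *)
pose dom (j : 'I_k) := [set S : {set 'I_n} | #|S| == n %/ k].
have domP Y : in_rect dom Y = in_domain Y by apply: eq_forallb => j; rewrite inE.
have in_rectI A Y : in_rect (fun j => A j :&: dom j) Y = in_rect A Y && in_domain Y.
  rewrite -domP; apply/forallP/andP => [YA|[/forallP YA /forallP Yd] j].
    by split; apply/forallP => j; have := YA j; rewrite inE => /andP[].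
  by rewrite inE YA Yd.
set d := nd_cost P in no_heavy.
(* The largest integer with [2 ^ d * M < #|I|]: more than [M] points make a rectangle heavy, and
   [2 ^ d] rectangles of at most [M] points cannot cover. *)
pose M := #|I|.-1 %/ 2 ^ d.
have boundM A : rect_avoids zero A -> #|[set i | in_rect A (X i)]| <= M.
  move=> zA; rewrite leqNgt; apply/negP => ltM; apply: no_heavy.
  exists (fun j => A j :&: dom j); split.
  - by move=> Y; rewrite in_rectI => /andP[/zA].
  - by move=> j S; rewrite !inE => /andP[_ /eqP].
  - have -> : [set i | in_rect (fun j => A j :&: dom j) (X i)] = [set i | in_rect A (X i)].
      by apply/setP => i; rewrite !inE in_rectI one_dom ?andbT.
    by rewrite -(prednK I_gt0) mulnC -ltn_divLR ?expn_gt0.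
have : #|I| <= size P * (2 ^ (\max_(p <- P) det_cost p) * M).
  apply: (@card_cover_le _ P (fun p i => (run p (X i)).1)) => [p pP|i]; last first.
    by have [p pP runp] := oneP _ (oneX i); exists p.
  have := @protocol_rect_bound zero M p (\max_(p <- P) det_cost p) dom boundM.
  have -> : [set s | in_rect dom (X s) && (run p (X s)).1] = [set i | (run p (X i)).1].
    by apply/setP => i; rewrite !inE domP one_dom.
  apply=> [Y _ /zeroP/(_ p pP) //|Y]; rewrite domP => Yd.
  apply: leq_trans (leq_bigmax_In _ pP); rewrite /det_cost.
  by rewrite (leq_bigmax_cond (F := fun Y => (run p Y).2)).
move/leq_trans => /(_ (2 ^ d * M)) le1.
have : #|I| <= 2 ^ d * M.
  by apply: le1; rewrite /d /nd_cost expnD mulnA leq_mul2r leq_mul2r up_logP ?orbT.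
rewrite leqNgt mulnC => /negP; apply; rewrite -[ltnRHS](prednK I_gt0) ltnS.
exact: leq_trunc_div.
Qed.

End Rectangles.

(** * Numerical estimates on exponentials *)

Section RealEstimates.

Local Open Scope R_scope.

Lemma exp_le_mono (x y : R) : x <= y -> exp x <= exp y.
Proof. by case=> [lt_xy | ->]; [left; apply: exp_increasing | right]. Qed.

Lemma exp_pow (x : R) (j : nat) : exp x ^ j = exp (INR j * x).
Proof. by rewrite -Rpower_pow; [rewrite /Rpower ln_exp | apply: exp_pos]. Qed.

Lemma ln2_bounds : 0 < ln 2 < 1.
Proof.
split; first by rewrite -ln_1; apply: ln_increasing; lra.
by rewrite -(ln_exp 1); apply: ln_increasing; have := exp_ineq1 1; lra.
Qed.

Lemma pow2_mul_lt_exp (c : nat) (r x : R) :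
  0 < x -> INR c < r - 2 * log2 x -> 2 ^ c * (x * x) < exp (r * ln 2).
Proof.
move=> x_gt0 c_lt; have [ln2_gt0 _] := ln2_bounds.
have xx_gt0 : 0 < x * x by nra.
have c_gt0 : 0 < 2 ^ c by apply: pow_lt; lra.
rewrite -(exp_ln (2 ^ c * (x * x))); last by apply: Rmult_lt_0_compat.
apply: exp_increasing; rewrite ln_mult // ln_mult // ln_pow; last by lra.
have := Rmult_lt_compat_r _ _ _ ln2_gt0 c_lt.
have -> : (r - 2 * log2 x) * ln 2 = r * ln 2 - 2 * ln x by rewrite /log2; field; lra.
lra.
Qed.

(* The term [2 * log2 n] of the bound pays for the factor [k] of a union bound
   over the parties. *)
Lemma tail_lt_inv_parties (n k m t c : nat) (gamma : R) :
    1 <= INR k -> INR k <= INR n -> INR n <= 2 * INR k * INR m ->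
    0 < gamma < 1 -> gamma * INR m / 4 <= INR t ->
    INR c < gamma * gamma * INR n / (10000 * INR k) - 2 * log2 (INR n) ->
  INR k * 2 ^ c * (1 + (gamma / 8) ^ 2 / 2) ^ m < (1 + gamma / 8) ^ t.
Proof.
move=> k_ge1 k_le_n n_le gamma01 t_ge c_lt.
have pow_gt0 : 0 < 2 ^ c by apply: pow_lt; lra.
have m_ge0 := pos_INR m; have t_ge0 := pos_INR t.
have [ln2_gt0 ln2_lt1] := ln2_bounds.
set g := gamma * gamma * INR n / (10000 * INR k) in c_lt.
have g_le : g <= gamma * gamma * INR m / 5000.
  apply: (Rmult_le_reg_r (10000 * INR k)); first lra.
  have -> : g * (10000 * INR k) = gamma * gamma * INR n by rewrite /g; field; lra.
  have -> : gamma * gamma * INR m / 5000 * (10000 * INR k)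
      = gamma * gamma * (2 * INR k * INR m) by field.
  by apply: Rmult_le_compat_l; nra.
have g_ge0 : 0 <= g.
  by apply: Rmult_le_pos; [nra | left; apply: Rinv_0_lt_compat; lra].
(* Here k <= n <= n^2, the factor n^2 is absorbed by the logarithmic term, and ln 2 < 1. *)
have parties_lt : INR k * 2 ^ c < exp (gamma * gamma * INR m / 5000).
  apply: (Rle_lt_trans _ (2 ^ c * (INR n * INR n))).
    by rewrite Rmult_comm; apply: Rmult_le_compat_l; nra.
  apply: Rlt_le_trans (pow2_mul_lt_exp _ c_lt) _; first lra.
  by apply: exp_le_mono; nra.
have moment_le : (1 + (gamma / 8) ^ 2 / 2) ^ m <= exp (INR m * (gamma * gamma / 128)).
  rewrite -exp_pow; apply: pow_incr; split; first nra.
  have -> : (gamma / 8) ^ 2 / 2 = gamma * gamma / 128 by field.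
  by apply/Rlt_le/exp_ineq1; nra.
(* exp(gamma/9) <= 1/(1 - gamma/9) <= 1 + gamma/8, the last step because gamma < 1; then t >= gamma
   m / 4 gives the exponent. *)
have tilt_ge : exp (gamma * gamma * INR m / 36) <= (1 + gamma / 8) ^ t.
  apply: (Rle_trans _ (exp (gamma / 9) ^ t)).
    by rewrite exp_pow; apply: exp_le_mono; nra.
  apply: pow_incr; split; first by left; apply: exp_pos.
  have := exp_ineq1 (- (gamma / 9)); rewrite exp_Ropp => inv_gt.
  have {}inv_gt : 1 - gamma / 9 < / exp (gamma / 9) by apply: inv_gt; lra.
  have e_gt0 := exp_pos (gamma / 9).
  by have := Rmult_lt_compat_r _ _ _ e_gt0 inv_gt; rewrite Rinv_l; nra.
apply: Rlt_le_trans tilt_ge.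
apply: (Rlt_le_trans _
  (exp (gamma * gamma * INR m / 5000) * exp (INR m * (gamma * gamma / 128)))).
  have := Rmult_lt_compat_r _ _ _ (exp_pos (INR m * (gamma * gamma / 128))) parties_lt.
  have : 0 < INR k * 2 ^ c by apply: Rmult_lt_0_compat; lra.
  nra.
(* The constants fit because 1/5000 + 1/128 < 1/36. *)
by rewrite -exp_plus; apply: exp_le_mono; nra.
Qed.

End RealEstimates.

(** * Hard inputs, sides of a heavy rectangle, and a common centre *)

Lemma disj_one_inhabited (k n : nat) : 0 < k -> exists X : input k n, disj_one X.
Proof.
move=> k_gt0; set m := n %/ k.
have ltn (i : 'I_k) (j : 'I_m) : i * m + j < n.
  apply: (@leq_trans (k * m)); last by rewrite mulnC leq_trunc_div.
  by rewrite (@leq_trans (i.+1 * m)) ?leq_mul2r ?ltn_ord ?orbT // mulSn addnC ltn_add2r.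
(* Party i receives the i-th block of m consecutive elements; division by m recovers i, whence
   disjointness. *)
exists [ffun i => [set Ordinal (ltn i j) | j : 'I_m]]; split.
  apply/forallP => i; rewrite ffunE card_imset ?card_ord // => j j' /(congr1 val) /= /addnI.
  exact: val_inj.
move=> i i' ii'; rewrite !ffunE; apply/pred0P => x /=.
apply/negP => /andP[/imsetP[j _ ->] /imsetP[j' _ /(congr1 val) /= eqij]].
have m_gt0 : 0 < m by apply: leq_ltn_trans (ltn_ord j).
move/eqP: ii'; apply; apply: val_inj => /=.
have := congr1 (divn^~ m) eqij.
by rewrite /= !divnMDl // !divn_small // !addn0.
Qed.

(** If the permuted tuple lies in the rectangle then its j-th set lies in [A j], and that set is
    uniform on the slice. *)
Lemma heavy_rect_side (k n c : nat) (X : input k n) (A : 'I_k -> {set {set 'I_n}}) :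
    in_domain X -> (forall j S, S \in A j -> #|S| = n %/ k) ->
    #|{perm 'I_n}| <=
      2 ^ c * #|[set s : {perm 'I_n} | in_rect A [ffun j => s @: X j]]| ->
  forall j, 'C(n, n %/ k) <= 2 ^ c * #|A j|.
Proof.
move=> /forallP Xd cardA heavy j.
have cardX : #|X j| = n %/ k by apply/eqP.
have := @card_perm_imset_in _ (X j) (A j).
rewrite cardX card_ord => /(_ (cardA j)) cardE.
rewrite -(leq_pmul2r (fact_gt0 n)) -mulnA -cardE mulnA mulnC leq_mul2r.
rewrite -[X in X`!](card_ord n) -card_perm_type (leq_trans heavy) ?orbT //.
rewrite leq_mul2l subset_leq_card ?orbT //.
by apply/subsetP => s; rewrite !inE => /forallP/(_ j); rewrite ffunE.
Qed.

Lemma exists_common_center (k n m t : nat) (A : 'I_k -> {set {set 'I_n}}) :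
    0 < k ->
    (forall j, k * #|[set C : {set 'I_n} | (#|C| == m) && (t <= slice_dist (A j) C)]|
                 < 'C(n, m)) ->
  exists2 C : {set 'I_n}, #|C| = m & forall j, slice_dist (A j) C < t.
Proof.
pose bad (j : 'I_k) := [set C : {set 'I_n} | (#|C| == m) && (t <= slice_dist (A j) C)].
move=> k_gt0 bad_lt; have {}bad_lt j : k * #|bad j| < 'C(n, m) := bad_lt j.
have [/existsP[C /andP[/eqP Cm /forallP goodC]]|] :=
  boolP [exists C : {set 'I_n}, (#|C| == m) && [forall j, slice_dist (A j) C < t]].
  by exists C.
rewrite negb_exists => /forallP all_bad; exfalso.
have : 'C(n, m) <= \sum_(j < k) #|bad j|.
  rewrite -[X in 'C(X, _)](card_ord n) -card_draws -sum1_card.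
  under [leqRHS]eq_bigr => j _ do rewrite -sum1_card big_mkcond /=.
  rewrite exchange_big /= big_mkcond; apply: leq_sum => C _; rewrite inE.
  case: ifP => // Cm; have := all_bad C; rewrite Cm negb_forall /= => /existsP[j].
  by rewrite -leqNgt => badC; rewrite (bigD1 j) //= inE Cm badC.
rewrite leqNgt => /negP; apply; rewrite -(ltn_pmul2l k_gt0) big_distrr /=.
rewrite (@leq_trans (\sum_(j < k) 'C(n, m))) //; last by rewrite sum_nat_const card_ord.
(* Each strict bound yields a unit of slack; the total slack k is positive, which keeps the summed
   inequality strict. *)
apply: (@leq_trans (\sum_(j < k) (k * #|bad j| + 1))); last first.
  by apply: leq_sum => j _; rewrite addn1 bad_lt.
by rewrite big_split sum1_card card_ord /= -[leqLHS]addn1 leq_add2l.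
Qed.

Lemma card_setD_sym (T : finType) (A B : {set T}) : #|A| = #|B| -> #|A :\: B| = #|B :\: A|.
Proof. by move=> eqAB; rewrite !cardsD eqAB setIC. Qed.

(** Triangle inequality through [C]. Equal sizes make differences symmetric, so each of the two
    one-sided differences is at most [d + d']. *)
Lemma symdiff_card_le (n d d' : nat) (X X' C : {set 'I_n}) :
    #|X| = #|C| -> #|X'| = #|C| -> #|C :\: X| <= d -> #|C :\: X'| <= d' ->
  symdiff_card X X' <= 2 * (d + d').
Proof.
move=> XC X'C Xd X'd.
have leD (B B' : {set 'I_n}) : #|B :\: B'| <= #|B :\: C| + #|C :\: B'|.
  apply: leq_trans (leq_card_setU _ _); apply/subset_leq_card/subsetP => x.
  by rewrite !inE; case: (x \in C); case: (x \in B); case: (x \in B').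
rewrite /symdiff_card mul2n -addnn; apply: leq_trans (leq_card_setU _ _) _.
apply: leq_add; apply: leq_trans (leD _ _) _.
  by rewrite leq_add // card_setD_sym.
by rewrite addnC leq_add // card_setD_sym.
Qed.

(** * The concentration bound with explicit constants *)

Section RealConcentration.

Local Open Scope R_scope.

Lemma slice_concentration_R (n m t : nat) (A : {set {set 'I_n}}) (q c : R) :
    (forall X : {set 'I_n}, X \in A -> #|X| = m) -> (m <= n)%N ->
    1 <= q -> q + / q <= 2 * c ->
  INR #|[set C : {set 'I_n} | (#|C| == m) && (t <= slice_dist A C)%N]| * INR #|A| * q ^ t
    <= c ^ m * INR 'C(n, m) ^ 2.
Proof.
move=> cardA lem q1 qc.
have := @slice_concentration R _ A q c m t cardA.
rewrite card_ord -!INRE -!RpowE => conc; apply/RleP.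
by apply: conc => //; apply/RleP.
Qed.

Lemma INR_exp2 (c : nat) : INR (expn 2 c) = 2 ^ c.
Proof. by elim: c => // c IHc; rewrite expnS mult_INR IHc. Qed.

Lemma few_far_sets (n k m t c : nat) (gamma : R) (A : {set {set 'I_n}}) :
    (forall X : {set 'I_n}, X \in A -> #|X| = m) -> (m <= n)%N -> 0 < gamma < 1 ->
    ('C(n, m) <= 2 ^ c * #|A|)%N ->
    INR k * 2 ^ c * (1 + (gamma / 8) ^ 2 / 2) ^ m < (1 + gamma / 8) ^ t ->
  (k * #|[set C : {set 'I_n} | (#|C| == m) && (t <= slice_dist A C)%N]| < 'C(n, m))%N.
Proof.
move=> cardA lem gamma01 /leP/le_INR; rewrite mult_INR INR_exp2 => heavy numeric.
set q := 1 + gamma / 8 in numeric; set v := (X in X ^ m) in numeric.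
(* With e = gamma/8, 1/q = 1 - e + e^2/q <= 1 - e + e^2, so q + 1/q <= 2 + e^2. *)
have qv : q + / q <= 2 * v.
  have -> : / q = 1 - gamma / 8 + (gamma / 8) ^ 2 * / q.
    by rewrite /q; field; lra.
  have : / q <= 1 by rewrite -Rinv_1; apply: Rinv_le_contravar; rewrite /q; lra.
  by rewrite /v /q; nra.
have := @slice_concentration_R n m t A q v cardA lem _ qv.
set bad := #|[set _ | _]| => conc; have {}conc := conc ltac:(rewrite /q; lra).
have C_gt0 : 0 < INR 'C(n, m) by apply: lt_0_INR; apply/ltP; rewrite bin_gt0.
have bad_ge0 := pos_INR bad; have k_ge0 := pos_INR k.
have qt_gt0 : 0 < q ^ t by apply: pow_lt; rewrite /q; lra.
have c_gt0 : 0 < 2 ^ c by apply: pow_lt; lra.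
apply/ltP/INR_lt; rewrite mult_INR; set C := INR 'C(n, m) in heavy conc C_gt0 *.
have bound : INR bad * q ^ t <= 2 ^ c * v ^ m * C.
  apply: (Rmult_le_reg_r C) => //.
  have : INR bad * q ^ t * C <= INR bad * q ^ t * (2 ^ c * INR #|A|).
    by apply: Rmult_le_compat_l => //; apply: Rmult_le_pos => //; lra.
  have : 2 ^ c * (INR bad * INR #|A| * q ^ t) <= 2 ^ c * (v ^ m * C ^ 2).
    by apply: Rmult_le_compat_l => //; lra.
  by lra.
apply: (Rmult_lt_reg_r (q ^ t)) => //.
apply: (Rle_lt_trans _ (INR k * (2 ^ c * v ^ m * C))).
  by rewrite Rmult_assoc; apply: Rmult_le_compat_l.
have := Rmult_lt_compat_r C _ _ C_gt0 numeric; lra.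
Qed.

Lemma nat_above (x : R) : 0 <= x ->
  exists t : nat, x <= INR t /\ INR t <= x + 1.
Proof.
move=> x0; have [up1 up2] := archimed x.
exists (Z.to_nat (up x)); rewrite INR_IZR_INZ Z2Nat.id; first by lra.
by apply: le_IZR; lra.
Qed.

End RealConcentration.

(** * The lower bound, by contradiction from a protocol that is too cheap *)

Theorem theorem3 :
  exists N : nat, forall (n k : nat) (gamma : R),
    (N <= n)%N -> (2 <= k)%N -> (k <= n - 1)%N ->
    Rlt 0 gamma -> Rlt gamma 1 ->
    Rle (Rdiv (INR k) gamma) (Rdiv (sqrt (INR n)) 100) ->
    ndcc_disj_ge k n gamma
      (Rminus (Rdiv (Rmult (Rmult gamma gamma) (INR n)) (Rmult 10000 (INR k)))
              (Rmult 2 (log2 (INR n)))).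
Proof.
exists 0 => n k gamma _ k_ge2 k_le gamma_gt0 gamma_lt1 _ P computesP.
apply: Rnot_lt_le => cost_lt; set m := n %/ k.
have k_gt0 : 0 < k by apply: leq_trans k_ge2.
have k_le_n : k <= n by apply: leq_trans k_le (leq_subr _ _).
have m_le_n : m <= n by apply: leq_div.
have [X X_one] := disj_one_inhabited n k_gt0.
pose Xs (s : {perm 'I_n}) : input k n := [ffun j => s @: X j].
have Xs_one s : disj_one (Xs s).
  have [/forallP Xd Xdisj] := X_one; split.
    by apply/forallP => j; rewrite ffunE card_imset //; apply: perm_inj.
  by move=> i j ij; rewrite !ffunE imset_disjoint ?Xdisj //; apply: perm_inj.
have perm_gt0 : 0 < #|{perm 'I_n}| by apply/card_gt0P; exists 1%g.
have one_dom (Y : input k n) : disj_one Y -> in_domain Y by case.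
have [A [A_avoids cardA heavy]] := exists_heavy_rect perm_gt0 computesP Xs_one one_dom.
have A_large := heavy_rect_side X_one.1 cardA heavy.
(* The lower bound on [t] feeds the tail estimate. The upper one gives 4 (t - 1) <= gamma m, the
   final bound on symmetric differences. *)
have [t [t_ge t_le]] : exists t : nat, Rle (Rdiv (Rmult gamma (INR m)) 4) (INR t) /\
    Rle (INR t) (Rplus (Rdiv (Rmult gamma (INR m)) 4) 1).
  by apply: nat_above; have := pos_INR m; nra.
(* The remainder of n modulo k is below k, hence below k m, as m >= 1. *)
have n_le : n <= 2 * k * m.
  rewrite {1}(divn_eq n k) -/m mulnAC mul2n -addnn mulnDl mulnC leq_add2l.
  by rewrite (leq_trans (ltnW (ltn_pmod n k_gt0))) // leq_pmulr // divn_gt0.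
have numeric : Rlt (Rmult (Rmult (INR k) (pow 2 (nd_cost P)))
      (pow (Rplus 1 (Rdiv (pow (Rdiv gamma 8) 2) 2)) m)) (pow (Rplus 1 (Rdiv gamma 8)) t).
  apply: (@tail_lt_inv_parties n) => //.
  - by apply: (le_INR 1); apply/leP.
  - by apply/le_INR/leP.
  - by move/leP/le_INR: n_le; rewrite !mult_INR.
have [C cardC C_close] := exists_common_center k_gt0 (fun j =>
  few_far_sets (cardA j) m_le_n (conj gamma_gt0 gamma_lt1) (A_large j) numeric).
have A_neq0 j : A j != set0.
  rewrite -card_gt0; have := A_large j; case: #|A j| => //.
  by rewrite muln0 leqNgt bin_gt0 m_le_n.
(* [Y j] is a member of [A j] nearest to the centre [C]; together they form the forbidden
   0-input. *)
have [Y YA Y_dist] := fin_all_exists2 (fun j => slice_dist_attained C (A_neq0 j)).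
pose Y' : input k n := [ffun j => Y j].
have cardY j : #|Y j| = m by apply: (cardA j).
apply: (A_avoids Y'); first by apply/forallP => j; rewrite ffunE.
split; first by apply/forallP => j; rewrite ffunE cardY.
move=> i j; rewrite !ffunE.
have t_gt0 : 0 < t by apply: leq_ltn_trans (C_close i).
have C_close' l : slice_dist (A l) C <= t.-1 by rewrite -ltnS prednK.
have := @symdiff_card_le n t.-1 t.-1 (Y i) (Y j) C.
rewrite !cardY cardC !Y_dist => /(_ erefl erefl (C_close' i) (C_close' j)).
move=> /leP/le_INR.
rewrite mult_INR plus_INR.
have : INR t = Rplus (INR t.-1) 1 by rewrite -S_INR prednK.
rewrite /= -/m; lra.
Qed.
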